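(* Let $G=(V,E)$ be a finite simple graph. Then there exists a surjective group homomorphism $\phi:W(\overline{G'})\to\mathcal{G}_G$, where $\overline{G'}$ is the complement of the dual graph $G'$ of $G$, $W(\overline{G'})$ is the right-angled Artin group associated with $\overline{G'}$, and $\mathcal{G}_G$ is the graph automaton group of $G$.
   Context: Graph automaton group: given a finite simple graph $G=(V,E)$, choose an orientation of every edge and let $E'$ be the resulting set of ordered pairs. Let $V^*$ be the set of finite words over the alphabet $V$. Each oriented edge $e=(x,y)\in E'$ acts as a length-preserving bijection of $V^*$ defined recursively by $e(\emptyset)=\emptyset$, $e(xw)=y\,e(w)$, $e(yw)=xw$, and $e(zw)=zw$ for $z\in V\setminus\{x,y\}$, $w\in V^*$. The group $\mathcal{G}_G$ is the group of bijections of $V^*$ generated by the elements of $E'$ (it does not depend on the orientation). The dual graph $G'$ of $G$ has vertex set $E$, and two distinct edges $e,f\in E$ are adjacent in $G'$ if they share a common vertex in $G$. The complement $\overline{H}$ of a graph $H$ has the same vertex set as $H$, two distinct vertices being adjacent in $\overline{H}$ if and only if they are not adjacent in $H$. The right-angled Artin group of a simple graph $H=(V_H,E_H)$ is $W(H)=\langle v\in V_H \mid vu=uv \text{ if } \{u,v\}\in E_H\rangle$. *)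

(* Defs.v *)
From HB Require Import structures.
From mathcomp Require Import all_boot.
From mathcomp Require Import all_classical.

Set Implicit Arguments.
Unset Strict Implicit.
Unset Printing Implicit Defensive.

Local Open Scope group_scope.

Record sgraph := SGraph {
  vertex :> finType;
  adj : rel vertex;
  adj_sym : symmetric adj;
  adj_irr : irreflexive adj
}.

Section GraphOperations.
Variable G : sgraph.

Definition is_edge (A : {set G}) : bool :=
  [exists x, exists y, adj x y && (A == [set x; y]%SET)].

Definition edge : finType := {A : {set G} | is_edge A}.

Definition dual_adj (e f : edge) : bool :=
  (e != f) && [exists x : G, (x \in val e) && (x \in val f)].

Fact dual_adj_sym : symmetric dual_adj.
Proof. move=> e f; rewrite /dual_adj eq_sym; congr (_ && _).
by apply: eq_existsb => x; rewrite andbC. Qed.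

Fact dual_adj_irr : irreflexive dual_adj.
Proof. by move=> e; rewrite /dual_adj eqxx. Qed.

Definition dual : sgraph := SGraph dual_adj_sym dual_adj_irr.

Definition compl_adj (x y : G) : bool := (x != y) && ~~ adj x y.

Fact compl_adj_sym : symmetric compl_adj.
Proof. by move=> x y; rewrite /compl_adj eq_sym adj_sym. Qed.

Fact compl_adj_irr : irreflexive compl_adj.
Proof. by move=> x; rewrite /compl_adj eqxx. Qed.

Definition compl : sgraph := SGraph compl_adj_sym compl_adj_irr.

Definition orientation (E' : {set G * G}) : Prop :=
  (forall x y, (x, y) \in E' -> adj x y) /\
  (forall x y, adj x y -> ((x, y) \in E') (+) ((y, x) \in E')).

End GraphOperations.

(* In group words, (x, true) is the letter x and (x, false) its formal inverse. *)

Section Presentation.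
Variables (X : choiceType) (R : seq (X * bool) -> seq (X * bool) -> Prop).

Definition gword : choiceType := seq (X * bool).

Inductive pres_eq : gword -> gword -> Prop :=
| pres_refl u : pres_eq u u
| pres_sym u v : pres_eq u v -> pres_eq v u
| pres_trans v u w : pres_eq u v -> pres_eq v w -> pres_eq u w
| pres_cat u u' v v' :
    pres_eq u u' -> pres_eq v v' -> pres_eq (u ++ v) (u' ++ v')
| pres_cancel x b : pres_eq [:: (x, b); (x, ~~ b)] [::]
| pres_rel u v : R u v -> pres_eq u v.

Definition pres_eqb : rel gword := fun u v => `[< pres_eq u v >].

Fact pres_eqb_refl : reflexive pres_eqb.
Proof. by move=> u; apply/asboolP; exact: pres_refl. Qed.

Fact pres_eqb_sym : symmetric pres_eqb.
Proof. by move=> u v; apply/asboolP/asboolP; exact: pres_sym. Qed.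

Fact pres_eqb_trans : transitive pres_eqb.
Proof.
by move=> v u w /asboolP uv /asboolP vw; apply/asboolP; exact: pres_trans vw.
Qed.

Canonical pres_equiv :=
  EquivRel pres_eqb pres_eqb_refl pres_eqb_sym pres_eqb_trans.

Definition presented : Type := {eq_quot pres_equiv}%qT.

HB.instance Definition _ := Choice.on presented.
HB.instance Definition _ := EqQuotient.on presented.

Definition pres_class (u : gword) : presented := (\pi_presented u)%qT.

Definition gword_inv (u : gword) : gword :=
  rev [seq (l.1, ~~ l.2) | l <- u].

Definition pres_mul (a b : presented) : presented :=
  pres_class (repr a ++ repr b).
Definition pres_inv (a : presented) : presented :=
  pres_class (gword_inv (repr a)).

Lemma pres_classP u v : pres_class u = pres_class v <-> pres_eq u v.
Proof. by split=> [/eqmodP/asboolP //|uv]; apply/eqmodP/asboolP. Qed.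

Lemma pres_class_repr a : pres_class (repr a) = a.
Proof. exact: reprK. Qed.

Lemma repr_pres_class u : pres_eq (repr (pres_class u)) u.
Proof. by apply/pres_classP; rewrite pres_class_repr. Qed.

Lemma pres_class_mul u v :
  pres_mul (pres_class u) (pres_class v) = pres_class (u ++ v).
Proof. by apply/pres_classP; apply: pres_cat; exact: repr_pres_class. Qed.

Fact pres_mulA : associative pres_mul.
Proof.
move=> a b c; rewrite -[a]pres_class_repr -[b]pres_class_repr.
by rewrite -[c]pres_class_repr !pres_class_mul catA.
Qed.

Fact pres_mul1 : left_id (pres_class [::]) pres_mul.
Proof. by move=> a; rewrite -[a]pres_class_repr pres_class_mul. Qed.

Fact pres_1mul : right_id (pres_class [::]) pres_mul.
Proof. by move=> a; rewrite -[a]pres_class_repr pres_class_mul cats0. Qed.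

Lemma gword_invK u : gword_inv (gword_inv u) = u.
Proof.
rewrite /gword_inv map_rev revK -map_comp map_id_in //.
by move=> [x b] _ /=; rewrite negbK.
Qed.

Lemma gword_mulV u : pres_eq (u ++ gword_inv u) [::].
Proof.
elim: u => [|[x b] u IH]; first exact: pres_refl.
rewrite /gword_inv /= rev_cons -cats1 -/(gword_inv u) catA.
apply: (pres_trans _ (pres_cancel x b)).
apply: (pres_cat (u := [:: (x, b)]) (u' := [:: (x, b)])
  (v' := [:: (x, ~~ b)])); first exact: pres_refl.
by apply: (pres_cat (u' := [::])) => //; exact: pres_refl.
Qed.

Fact pres_mulV : right_inverse (pres_class [::]) pres_inv pres_mul.
Proof.
move=> a; rewrite -{1}[a]pres_class_repr pres_class_mul.
by apply/pres_classP; exact: gword_mulV.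
Qed.

Fact pres_Vmul : left_inverse (pres_class [::]) pres_inv pres_mul.
Proof.
move=> a; rewrite -{2}[a]pres_class_repr pres_class_mul.
apply/pres_classP; rewrite -{2}[repr a]gword_invK; exact: gword_mulV.
Qed.

HB.instance Definition _ := isGroup.Build presented
  pres_mulA pres_mul1 pres_1mul pres_Vmul pres_mulV.

End Presentation.

Definition raag_rel (H : sgraph) (r s : seq (H * bool)) : Prop :=
  exists u v : H, [/\ adj u v, r = [:: (v, true); (u, true)]
                             & s = [:: (u, true); (v, true)]].

Definition raag (H : sgraph) : groupType := presented (@raag_rel H).

Record bijection (T : choiceType) := Bij {
  bij_fun :> T -> T;
  bij_funP : `[< bijective bij_fun >]
}.

HB.instance Definition _ (T : choiceType) := [isSub for @bij_fun T].
HB.instance Definition _ (T : choiceType) := [Choice of bijection T by <:].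

Section BijGroup.
Variable T : choiceType.

Lemma bijP (f g : bijection T) : f =1 g -> f = g.
Proof. by move=> fg; apply/val_inj/funext. Qed.

Fact bij_one_subproof : `[< bijective (@id T) >].
Proof. by apply/asboolP; exists id. Qed.
Definition bij_one : bijection T := Bij bij_one_subproof.

Fact bij_mul_subproof (f g : bijection T) : `[< bijective (f \o g) >].
Proof. by apply/asboolP; apply: bij_comp; apply/asboolP/bij_funP. Qed.
Definition bij_mul (f g : bijection T) : bijection T := Bij (bij_mul_subproof f g).

Fact bij_inv_exists (f : bijection T) :
  exists g : bijection T, cancel f g /\ cancel g f.
Proof.
have /asboolP[g fK gK] := bij_funP f.
have gP : `[< bijective g >] by apply/asboolP; exists f.
by exists (Bij gP).
Qed.
Definition bij_inv (f : bijection T) : bijection T := projT1 (cid (bij_inv_exists f)).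

Lemma bij_invP (f : bijection T) : cancel f (bij_inv f) /\ cancel (bij_inv f) f.
Proof. exact: projT2 (cid (bij_inv_exists f)). Qed.

Fact bij_mulA : associative bij_mul.
Proof. by move=> f g h; apply: bijP. Qed.
Fact bij_mul1 : left_id bij_one bij_mul.
Proof. by move=> f; apply: bijP. Qed.
Fact bij_1mul : right_id bij_one bij_mul.
Proof. by move=> f; apply: bijP. Qed.
Fact bij_Vmul : left_inverse bij_one bij_inv bij_mul.
Proof. by move=> f; apply: bijP => x; have [fK _] := bij_invP f; exact: fK. Qed.
Fact bij_mulV : right_inverse bij_one bij_inv bij_mul.
Proof. by move=> f; apply: bijP => x; have [_ gK] := bij_invP f; exact: gK. Qed.

HB.instance Definition _ := isGroup.Build (bijection T)
  bij_mulA bij_mul1 bij_1mul bij_Vmul bij_mulV.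

End BijGroup.

Section Generated.
Variables (gT : groupType) (A : set gT).

Definition gen_set : set gT :=
  smallest (fun S : set gT => group_closed [in S]) A.

Record gen_group := GenGroup {
  gen_val :> gT;
  gen_valP : gen_val \in gen_set
}.

HB.instance Definition _ := [isSub for gen_val].
HB.instance Definition _ := [Choice of gen_group by <:].

Fact gen_group_closed : group_closed (fun x => x \in gen_set).
Proof.
split=> [|x y xS yS]; rewrite -topredE /=; apply/mem_set => S [[S1 SV] AS].
  exact: set_mem S1.
apply/set_mem/SV; apply/mem_set.
  exact: (set_mem (xS : x \in gen_set)).
exact: (set_mem (yS : y \in gen_set)).
Qed.

HB.instance Definition _ := SubChoice_isSubGroup.Build gT
  (fun x => x \in gen_set) gen_group gen_group_closed.

End Generated.

Fixpoint edge_act (V : eqType) (x y : V) (w : seq V) : seq V :=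
  if w is z :: w' then
    if z == x then y :: edge_act x y w'
    else if z == y then x :: w'
    else z :: w'
  else [::].

Fixpoint edge_act_inv (V : eqType) (x y : V) (w : seq V) : seq V :=
  if w is z :: w' then
    if z == y then x :: edge_act_inv x y w'
    else if z == x then y :: w'
    else z :: w'
  else [::].

Lemma edge_actxx (V : eqType) (x : V) : edge_act x x =1 id.
Proof. by elim=> //= z w ->; case: eqVneq => // ->. Qed.

Lemma edge_act_invxx (V : eqType) (x : V) : edge_act_inv x x =1 id.
Proof. by elim=> //= z w ->; case: eqVneq => // ->. Qed.

Fact edge_actK (V : eqType) (x y : V) :
  cancel (edge_act x y) (edge_act_inv x y).
Proof.
have [->|xy w] := eqVneq x y.
  by move=> w; rewrite edge_actxx edge_act_invxx.
elim: w => //= z w IH; have [->|zx] := eqVneq z x; first by rewrite /= eqxx IH.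
have [->|zy] := eqVneq z y => /=; last by rewrite (negPf zy) (negPf zx).
by rewrite (negPf xy) eqxx.
Qed.

Fact edge_act_invK (V : eqType) (x y : V) :
  cancel (edge_act_inv x y) (edge_act x y).
Proof.
have [->|xy w] := eqVneq x y.
  by move=> w; rewrite edge_actxx edge_act_invxx.
elim: w => //= z w IH; have [->|zy] := eqVneq z y; first by rewrite /= eqxx IH.
have [->|zx] := eqVneq z x => /=; last by rewrite (negPf zx) (negPf zy).
by rewrite eq_sym (negPf xy) eqxx.
Qed.

Fact edge_act_bij (V : eqType) (x y : V) : `[< bijective (edge_act x y) >].
Proof.
by apply/asboolP; exists (edge_act_inv x y);
  [exact: edge_actK | exact: edge_act_invK].
Qed.

Definition edge_bij (V : choiceType) (x y : V) : bijection (seq V) :=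
  Bij (edge_act_bij x y).

Definition graph_automaton_group (G : sgraph) (E' : {set G * G}) : groupType :=
  gen_group [set edge_bij p.1 p.2 | p in [set` E']]%classic.

(* Main.v *)
From HB Require Import structures.
Require Import Defs.
From mathcomp Require Import all_classical.
From mathcomp Require Import all_boot.

(** Send each edge of G, a vertex of the complement of the dual graph, to the
    automorphism given by its orientation. Edges adjacent in that complement
    have no common endpoint, and their automorphisms commute: each one leaves
    unchanged every word that starts with an endpoint of the other. So the
    assignment extends to the right-angled Artin group, and the image is a
    subgroup containing all the generators. *)

Set Implicit Arguments.
Unset Strict Implicit.
Unset Printing Implicit Defensive.

Section PresentedLift.
Local Open Scope group_scope.
Variables (X : choiceType) (R : seq (X * bool) -> seq (X * bool) -> Prop).
Variables (gT : groupType) (f : X -> gT).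

Definition word_eval (u : seq (X * bool)) : gT :=
  \prod_(l <- u) (if l.2 then f l.1 else (f l.1)^-1).

Hypothesis Rf : forall u v, R u v -> word_eval u = word_eval v.

Lemma word_eval_pres_eq u v : pres_eq R u v -> word_eval u = word_eval v.
Proof.
elim=> {u v} // [u v w _ -> _ -> //|u u' v v' _ IHu _ IHv|x b].
  by rewrite /word_eval !big_cat /= -!/(word_eval _) IHu IHv.
rewrite /word_eval !big_cons !big_nil mulg1 /=.
by case: b; rewrite /= ?mulgV ?mulVg.
Qed.

Definition presented_lift (a : presented R) : gT := word_eval (repr a).

Lemma presented_lift_class u : presented_lift (pres_class R u) = word_eval u.
Proof. exact/word_eval_pres_eq/repr_pres_class. Qed.

Lemma presented_liftM : {morph presented_lift : a b / a * b}.
Proof. by move=> a b; rewrite /= presented_lift_class /word_eval big_cat. Qed.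

(** Existence half of the universal property of a presentation: evaluation of words respects [R],
    hence all of [pres_eq], and so descends to classes. *)
Lemma presented_universal :
  exists phi : {multiplicative presented R -> gT},
    forall x, phi (pres_class R [:: (x, true)]) = f x.
Proof.
pose liftM := isMultiplicative.Build (presented R) gT _ presented_liftM.
pose phi : {multiplicative presented R -> gT} := HB.pack presented_lift liftM.
by exists phi => x; rewrite /= presented_lift_class /word_eval big_seq1.
Qed.

End PresentedLift.

Section GeneratedSurjection.
Local Open Scope group_scope.
Variables (gT hT : groupType) (A : set gT).
Variable phi : {multiplicative hT -> gen_group A}.

(* [gmulfF] requires a morphism that is already known to preserve 1. *)
Lemma multiplicativeF : {morph phi : v w / v / w}.
Proof. by move=> v w; apply: (mulIg (phi w)); rewrite -gmulfM !mulgVK. Qed.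

(** The values of [phi] form a subgroup containing [A], and [gen_set A] is the smallest such
    subgroup. *)
Lemma gen_group_surj :
  (forall a, A a -> exists w, val (phi w) = a) ->
  forall g, exists w, phi w = g.
Proof.
move=> Aphi g.
suff [w wg] : exists w, val (phi w) = val g.
  by exists w; apply: val_inj.
have /set_mem := gen_valP g.
apply: (_ : gen_set A `<=` [set h | exists w, val (phi w) = h])%classic.
apply: smallest_sub => //; split=> [|x y /set_mem[v <-] /set_mem[w <-]].
  (* The identity is reached through [phi (1 / 1) = phi 1 / phi 1]. *)
  by apply/mem_set; exists 1; rewrite -(divgg 1) multiplicativeF divgg.
by apply/mem_set; exists (v / w); rewrite multiplicativeF.
Qed.

End GeneratedSurjection.

Lemma edge_act_comm (V : eqType) (x y z t : V) :
  x != z -> x != t -> y != z -> y != t ->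
  edge_act x y \o edge_act z t =1 edge_act z t \o edge_act x y.
Proof.
move=> xz xt yz yt [|a w] //=.
have [->|ax] := eqVneq a x.
  by rewrite (negPf xz) (negPf xt) /= eqxx (negPf yz) (negPf yt).
have [ay|ay] := eqVneq a y.
  by rewrite -ay in yz yt *; rewrite (negPf yz) (negPf yt) /= (negPf ax) eqxx
    /= (negPf xz) (negPf xt).
rewrite /=; have [_|az] := eqVneq a z.
  by rewrite /= ![t == _]eq_sym (negPf xt) (negPf yt).
have [_|at_] := eqVneq a t.
  by rewrite /= ![z == _]eq_sym (negPf xz) (negPf yz).
by rewrite /= (negPf ax) (negPf ay).
Qed.

Section EdgeOrientation.
Variables (G : sgraph) (E' : {set G * G}).
Hypothesis hE' : orientation E'.

Lemma oriented_edge (e : edge G) :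
  exists2 p : G * G, p \in E' & val e = [set p.1; p.2].
Proof.
have [_ oE] := hE'; have /existsP[x /existsP[y /andP[xy /eqP ->]]] := valP e.
case: (boolP ((x, y) \in E')) (oE x y xy) => [? _|_ /= yxE].
  by exists (x, y).
by exists (y, x) => //=; rewrite finset.setUC.
Qed.

(** Equal unordered pairs leave only [p = q] or [p] reversed; the exclusive or in [orientation]
    rules out the reversal, irreflexivity the degenerate cases. *)
Lemma orientation_inj (p q : G * G) : p \in E' -> q \in E' ->
  [set p.1; p.2] = [set q.1; q.2] -> p = q.
Proof.
have [E'adj oE] := hE'; case: p q => [x y] [z t] /= xyE ztE eqe.
have xy : x != y by apply: contraTneq (E'adj _ _ xyE) => ->; rewrite adj_irr.
have: x \in [set z; t] by rewrite -eqe !inE eqxx.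
have: y \in [set z; t] by rewrite -eqe !inE eqxx orbT.
rewrite !inE => /orP[]/eqP yE /orP[]/eqP xE; subst x y.
- by rewrite eqxx in xy.
- by have := oE _ _ (E'adj _ _ ztE); rewrite ztE xyE.
- by [].
- by rewrite eqxx in xy.
Qed.

(** The pair is picked by choice, but by [orientation_inj] it is the only candidate. *)
Definition orient (e : edge G) : G * G := s2val (cid2 (oriented_edge e)).

Lemma orient_in e : orient e \in E'.
Proof. exact: s2valP (cid2 (oriented_edge e)). Qed.

Lemma orientE e : val e = [set (orient e).1; (orient e).2].
Proof. exact: s2valP' (cid2 (oriented_edge e)). Qed.

Lemma orient_surj p : p \in E' -> exists e, orient e = p.
Proof.
move=> pE; have [E'adj _] := hE'.
have ep : is_edge [set p.1; p.2].
  apply/existsP; exists p.1; apply/existsP; exists p.2.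
  by rewrite eqxx andbT E'adj -?surjective_pairing.
exists (exist (@is_edge G) _ ep); apply: orientation_inj => //; first exact: orient_in.
by rewrite -orientE.
Qed.

Fact edge_gen_subproof (e : edge G) :
  edge_bij (orient e).1 (orient e).2 \in
    gen_set [set edge_bij p.1 p.2 | p in [set` E']]%classic.
Proof.
by apply/mem_set => S [_]; apply; exists (orient e) => //; exact: orient_in.
Qed.

Definition edge_gen (e : edge G) : graph_automaton_group E' :=
  GenGroup (edge_gen_subproof e).

Lemma edge_gen_comm (e f : edge G) : @adj (compl (dual G)) e f ->
  (edge_gen e * edge_gen f = edge_gen f * edge_gen e)%g.
Proof.
(* As [e] and [f] are distinct, non-adjacency in the dual graph means exactly that they share no
   endpoint. *)
case/andP=> ef; rewrite /= /dual_adj ef /= negb_exists => /forallP disj.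
have dneq x y : x \in val e -> y \in val f -> x != y.
  by move=> xe yf; apply: contraNneq (disj x) => eqxy; rewrite xe eqxy.
apply: val_inj; apply: bijP; apply: edge_act_comm; apply: dneq;
  by rewrite orientE !inE eqxx ?orbT.
Qed.

End EdgeOrientation.

Theorem proposition3p4 (G : sgraph) (E' : {set G * G}) (hE' : orientation E') :
  exists phi : {multiplicative raag (compl (dual G)) -> graph_automaton_group E'},
    forall g : graph_automaton_group E',
      exists w : raag (compl (dual G)), phi w = g.
Proof.
have relf u v : @raag_rel (compl (dual G)) u v ->
    word_eval (edge_gen hE') u = word_eval (edge_gen hE') v.
  move=> [e [f [ef -> ->]]]; rewrite /word_eval !big_cons big_nil /= !mulg1.
  exact/esym/edge_gen_comm.
have [phi phi_gen] := presented_universal relf; exists phi.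
(* Each generator is the image of the vertex given by its underlying edge. *)
apply: gen_group_surj => _ [p pE <-]; have [e ep] := orient_surj hE' pE.
by exists (pres_class _ [:: (e, true)]); rewrite phi_gen /= ep.
Qed.
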